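(* Every multilinear polynomial identity of degree $\le 5$ satisfied by the partially alternating ternary sum (over $\mathbb{Q}$) is a consequence of the two identities $P(a,b,c)\equiv 0$ and $Q(a,b,c,d,e)\equiv 0$, where $$P(a,b,c)=(a,b,c)+(a,c,b),\qquad Q(a,b,c,d,e)=(a,(b,c,d),e)+(a,(c,b,d),e).$$
   Context: The base field is $\mathbb{Q}$. An (associative) dialgebra is a vector space $A$ with two bilinear products $\dashv,\vdash$ satisfying $(a\dashv b)\dashv c=a\dashv(b\dashv c)$, $(a\vdash b)\vdash c=a\vdash(b\vdash c)$, $(a\vdash b)\dashv c=a\vdash(b\dashv c)$, $(a\dashv b)\vdash c=(a\vdash b)\vdash c$, $a\dashv(b\dashv c)=a\dashv(b\vdash c)$. The partially alternating ternary sum (PATS) is the trilinear operation on a dialgebra $$[a,b,c]=a\dashv b\dashv c-a\dashv c\dashv b-b\vdash a\dashv c+c\vdash a\dashv b+b\vdash c\vdash a-c\vdash b\vdash a .$$ A ternary algebra is a vector space with a trilinear product $(\cdot,\cdot,\cdot)$. A (ternary) polynomial of degree $n$ is a linear combination of monomials of degree $n$ in the free (nonassociative) ternary algebra on a set of variables; it is multilinear if each of $n$ variables occurs exactly once in each monomial. A polynomial identity $f\equiv 0$ is satisfied by the PATS if $f$ vanishes for all values of the variables in every dialgebra when $(\cdot,\cdot,\cdot)$ is interpreted as the PATS. An identity is a consequence of a set of identities if it holds in every ternary algebra over $\mathbb{Q}$ satisfying all the identities of that set. *)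

(* Defs.v *)
From HB Require Import structures.
From mathcomp Require Import all_boot all_order all_algebra.
From mathcomp Require Import finmap.
From mathcomp.multinomials Require Import monalg.

Set Implicit Arguments.
Unset Strict Implicit.
Unset Printing Implicit Defensive.

Import GRing.Theory.
Local Open Scope ring_scope.

Reserved Notation "a ⊣ b" (at level 40, left associativity).
Reserved Notation "a ⊢ b" (at level 40, left associativity).

Record dialgebra := Dialgebra {
  di_sort :> lmodType rat;
  di_left : di_sort -> di_sort -> di_sort;
  di_right : di_sort -> di_sort -> di_sort;
  di_left_linear_r : forall a, linear (di_left a);
  di_left_linear_l : forall b, linear (fun a => di_left a b);
  di_right_linear_r : forall a, linear (di_right a);
  di_right_linear_l : forall b, linear (fun a => di_right a b);
  di_leftA : forall a b c, di_left (di_left a b) c = di_left a (di_left b c);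
  di_rightA : forall a b c, di_right (di_right a b) c = di_right a (di_right b c);
  di_innerA : forall a b c, di_left (di_right a b) c = di_right a (di_left b c);
  di_right_bar : forall a b c, di_right (di_left a b) c = di_right (di_right a b) c;
  di_left_bar : forall a b c, di_left a (di_left b c) = di_left a (di_right b c)
}.

Notation "a ⊣ b" := (di_left a b) : ring_scope.
Notation "a ⊢ b" := (di_right a b) : ring_scope.

(* Both products are read as left associative; by the dialgebra axioms the
   other bracketing of each of the six terms gives the same element. *)
Definition pats (D : dialgebra) (a b c : D) : D :=
  a ⊣ b ⊣ c - a ⊣ c ⊣ b - b ⊢ a ⊣ c + c ⊢ a ⊣ b
  + b ⊢ c ⊢ a - c ⊢ b ⊢ a.

Record ternary_algebra := TernaryAlgebra {
  ta_sort :> lmodType rat;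
  ta_op : ta_sort -> ta_sort -> ta_sort -> ta_sort;
  ta_linear1 : forall b c, linear (fun a => ta_op a b c);
  ta_linear2 : forall a c, linear (fun b => ta_op a b c);
  ta_linear3 : forall a b, linear (ta_op a b)
}.

(* Monomials of the free nonassociative ternary algebra on X. *)
Inductive tmon (X : Type) : Type :=
| TVar of X
| TOp of tmon X & tmon X & tmon X.
Arguments TVar {X} _.
Arguments TOp {X} _ _ _.

Section TmonChoice.
Variable X : choiceType.

Fixpoint tmon_encode (m : tmon X) : GenTree.tree X :=
  match m with
  | TVar x => GenTree.Leaf x
  | TOp m1 m2 m3 =>
      GenTree.Node 0 [:: tmon_encode m1; tmon_encode m2; tmon_encode m3]
  end.

Fixpoint tmon_decode (t : GenTree.tree X) : option (tmon X) :=
  match t with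
  | GenTree.Leaf x => Some (TVar x)
  | GenTree.Node _ [:: t1; t2; t3] =>
      match tmon_decode t1, tmon_decode t2, tmon_decode t3 with
      | Some m1, Some m2, Some m3 => Some (TOp m1 m2 m3)
      | _, _, _ => None
      end
  | _ => None
  end.

Lemma tmon_encodeK : pcancel tmon_encode tmon_decode.
Proof. by elim=> //= m1 -> m2 -> m3 ->. Qed.

HB.instance Definition _ := Choice.copy (tmon X) (pcan_type tmon_encodeK).

End TmonChoice.

(* The variables are indexed by nat. *)
Notation tpoly := {malg rat[tmon nat]}.

Fixpoint tmon_vars (X : Type) (m : tmon X) : seq X :=
  match m with
  | TVar x => [:: x]
  | TOp m1 m2 m3 => tmon_vars m1 ++ tmon_vars m2 ++ tmon_vars m3
  end.

(* f is multilinear of degree n: for some set of n variables, given by the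
   duplicate-free sequence s, each variable of s occurs exactly once, and no
   other variable occurs, in each monomial of f. *)
Definition multilinear (n : nat) (f : tpoly) : Prop :=
  exists s : seq nat,
    [/\ uniq s, size s = n & forall m, m \in msupp f -> perm_eq (tmon_vars m) s].

Fixpoint tmon_eval (X A : Type) (op : A -> A -> A -> A) (v : X -> A)
    (m : tmon X) : A :=
  match m with
  | TVar x => v x
  | TOp m1 m2 m3 =>
      op (tmon_eval op v m1) (tmon_eval op v m2) (tmon_eval op v m3)
  end.

Definition tpoly_eval (A : lmodType rat) (op : A -> A -> A -> A) (v : nat -> A)
    (f : tpoly) : A :=
  \sum_(m <- msupp f) f@_m *: tmon_eval op v m.

Definition satisfies (A : lmodType rat) (op : A -> A -> A -> A) (f : tpoly) :
    Prop :=
  forall v : nat -> A, tpoly_eval op v f = 0.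

Definition pats_identity (f : tpoly) : Prop :=
  forall D : dialgebra, satisfies (@pats D) f.

Definition consequence (E : tpoly -> Prop) (f : tpoly) : Prop :=
  forall T : ternary_algebra,
    (forall g, E g -> satisfies (@ta_op T) g) -> satisfies (@ta_op T) f.

Definition identP : tpoly :=
  let: (a, b, c) := (TVar 0%N, TVar 1%N, TVar 2%N) in
  << TOp a b c >> + << TOp a c b >>.

Definition identQ : tpoly :=
  let: (a, b, c, d, e) :=
    (TVar 0%N, TVar 1%N, TVar 2%N, TVar 3%N, TVar 4%N) in
  << TOp a (TOp b c d) e >> + << TOp a (TOp c b d) e >>.

(* Main.v *)
(* In every dialgebra A x A, with A associative, the PATS has components
   alt3 x.1 y.2 z.2 and alt3 x.2 y.2 z.2, where alt3 is the alternating sum of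
   the six products. Modulo P and Q, a monomial of degree 5 is a multiple of
   ((a,b,c),d,e), alternating in {b,c} and in {d,e}, or of (a,(b,c,d),e),
   alternating in {b,c,d}. With A free, for each of these two normal forms a
   combination of four words in a, b, c, d, e is a functional on the values of
   the PATS that takes a nonzero value on that normal form and vanishes on all
   others. Applied to all renamings of the variables, these functionals read
   off the coordinates of a polynomial modulo P and Q from its value, so these
   coordinates are zero for an identity of the PATS. *)
Require Import Defs.
From mathcomp Require Import all_boot all_order all_algebra.
From mathcomp Require Import finmap zify.
From mathcomp.multinomials Require Import monalg.

Set Implicit Arguments.
Unset Strict Implicit.
Unset Printing Implicit Defensive.

Import GRing.Theory.
Local Open Scope ring_scope.

(** * The dialgebra of pairs over an algebra *)

Definition alt3 (R : pzRingType) (a b c : R) : R :=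
  a * b * c - a * c * b - b * a * c + c * a * b + b * c * a - c * b * a.

Lemma alt3_0l (R : pzRingType) (b c : R) : alt3 0 b c = 0.
Proof. by rewrite /alt3 !(mul0r, mulr0) !subr0 !addr0. Qed.

(** Additive maps of rational vector spaces commute with integer multiples, hence with fractions.
    Linearity axioms thus reduce to distributivity. *)
Lemma zmod_morphism_linear (U V : lmodType rat) (h : U -> V) :
  zmod_morphism h -> linear h.
Proof.
move=> hB a u v.
have h0 : h 0 = 0 by rewrite -(subrr 0) hB subrr.
have hN x : h (- x) = - h x by rewrite -sub0r hB h0 sub0r.
by rewrite -{1}(opprK v) hB hN opprK rat_linear.
Qed.

Definition pair_left (A : lalgType rat) (x y : A * A) : A * A :=
  (x.1 * y.2, x.2 * y.2).

Definition pair_right (A : lalgType rat) (x y : A * A) : A * A :=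
  (x.2 * y.1, x.2 * y.2).

(* The first component of a product of several factors is the product in A of
   the first component of the central factor and the second components of the
   other factors. *)
Program Definition pair_dialgebra (A : lalgType rat) : dialgebra :=
  @Dialgebra (A * A)%type (@pair_left A) (@pair_right A) _ _ _ _ _ _ _ _ _.
Next Obligation.
by apply: zmod_morphism_linear => x y; rewrite /pair_left /= !mulrBr.
Qed.
Next Obligation.
by apply: zmod_morphism_linear => x y; rewrite /pair_left /= !mulrBl.
Qed.
Next Obligation.
by apply: zmod_morphism_linear => x y; rewrite /pair_right /= !mulrBr.
Qed.
Next Obligation.
by apply: zmod_morphism_linear => x y; rewrite /pair_right /= !mulrBl.
Qed.
Next Obligation. by rewrite /pair_left /= !mulrA. Qed.
Next Obligation. by rewrite /pair_right /= !mulrA. Qed.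
Next Obligation. by rewrite /pair_left /pair_right /= !mulrA. Qed.

Lemma pats_pair (A : lalgType rat) (x y z : pair_dialgebra A) :
  pats x y z = (alt3 x.1 y.2 z.2, alt3 x.2 y.2 z.2).
Proof. by []. Qed.

(** * Renamings of variables and words with integer coefficients *)

Definition tmon_subst (g : nat -> nat) (m : tmon nat) : tmon nat :=
  tmon_eval (@TOp nat) (fun x => TVar (g x)) m.

(* In [a,b,c] every term is centred at a, hence the recursion on the first
   factor. *)
Definition center (m : tmon nat) : nat := tmon_eval (fun a _ _ => a) id m.

Lemma eval_tmon_subst (A : Type) (op : A -> A -> A -> A) v g m :
  tmon_eval op v (tmon_subst g m) = tmon_eval op (fun x => v (g x)) m.
Proof. by elim: m => //= m1 -> m2 -> m3 ->. Qed.

Lemma size_tmon_vars_subst g m :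
  size (tmon_vars (tmon_subst g m)) = size (tmon_vars m).
Proof. by elim: m => //= m1 IH1 m2 IH2 m3 IH3; rewrite !size_cat IH1 IH2 IH3. Qed.

Lemma eq_in_tmon_eval (A : Type) (op : A -> A -> A -> A) (v w : nat -> A) m :
  {in tmon_vars m, v =1 w} -> tmon_eval op v m = tmon_eval op w m.
Proof.
elim: m => [x|m1 IH1 m2 IH2 m3 IH3] /= vw; first by rewrite vw ?mem_head.
rewrite IH1 ?IH2 ?IH3 // => x xm; apply: vw; by rewrite !mem_cat xm ?orbT.
Qed.

(** Lists of words, equal ones not collected, so that coordinates can be computed. *)
Definition wpoly := seq (int * seq nat).

Definition wopp (p : wpoly) : wpoly := [seq (- t.1, t.2) | t <- p].

Definition wmul (p q : wpoly) : wpoly :=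
  [seq (t.1 * u.1, t.2 ++ u.2) | t <- p, u <- q].

Definition walt3 (a b c : wpoly) : wpoly :=
  ((((wmul (wmul a b) c ++ wopp (wmul (wmul a c) b))
  ++ wopp (wmul (wmul b a) c)) ++ wmul (wmul c a) b) ++ wmul (wmul b c) a)
  ++ wopp (wmul (wmul c b) a).

Definition words (m : tmon nat) : wpoly :=
  tmon_eval walt3 (fun x => [:: (1, [:: x])]) m.

Notation free_alg := {malg rat[{fmonom nat}]}.

Definition wval (p : wpoly) : free_alg :=
  \sum_(t <- p) << t.1%:~R *g FMonom t.2 >>.

Lemma wval_cat p q : wval (p ++ q) = wval p + wval q.
Proof. exact: big_cat. Qed.

Lemma wval_opp p : wval (wopp p) = - wval p.
Proof.
rewrite /wval big_map -sumrN; apply: eq_bigr => t _.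
by rewrite /= mulrNz monalgUN.
Qed.

Lemma wval_mul p q : wval (wmul p q) = wval p * wval q.
Proof.
rewrite /wval big_allpairs_dep mulr_suml; apply: eq_bigr => t _.
rewrite mulr_sumr; apply: eq_bigr => u _ /=.
by rewrite malgM_def fgmulUU intrM -(fmmulE (FMonom t.2) (FMonom u.2)).
Qed.

Lemma wval_alt3 a b c : wval (walt3 a b c) = alt3 (wval a) (wval b) (wval c).
Proof. by rewrite /walt3 !wval_cat !wval_opp !wval_mul. Qed.

(* Only monomials with centre 0 have a nonzero first component. *)
Definition generic (i : nat) : pair_dialgebra free_alg :=
  let x := << FMonom [:: i] >> in (if i == 0 then x else 0, x).

(** [alt3] vanishes when its first argument does, so the centre alone decides whether the first
    component is replaced by 0. *)
Lemma tmon_eval_generic m :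
  tmon_eval (@pats _) generic m =
    (if center m == 0 then wval (words m) else 0, wval (words m)).
Proof.
elim: m => [x|m1 IH1 m2 IH2 m3 IH3] /=.
  by rewrite /wval /words /= big_seq1 /= /center /=.
have -> : wval (words (TOp m1 m2 m3)) =
    alt3 (wval (words m1)) (wval (words m2)) (wval (words m3)).
  exact: wval_alt3.
rewrite IH1 IH2 IH3 pats_pair /= /center /=.
by case: ifP => _; rewrite ?alt3_0l.
Qed.

(** * Functionals on the values of the PATS *)

Definition pairing (L p : wpoly) : int :=
  foldr +%R 0 [seq (if t.2 == u.2 then t.1 * u.1 else 0) | t <- L, u <- p].

Definition coordinate (L : wpoly) (m : tmon nat) : int :=
  if center m == 0 then pairing L (words m) else 0.

Lemma pairingE L p :
  (pairing L p)%:~R = \sum_(t <- L) t.1%:~R * (wval p)@_(FMonom t.2).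
Proof.
rewrite /pairing foldrE big_allpairs_dep rmorph_sum; apply: eq_bigr => t _.
rewrite rmorph_sum /wval raddf_sum mulr_sumr; apply: eq_bigr => u _ /=.
rewrite mcoeffU -val_eqE /= eq_sym; case: eqP => _.
  by rewrite rmorphM.
by rewrite mulr0n mulr0.
Qed.

(** The value of [f] at the generic elements renamed by [g] is zero; the functional [L] is applied
    to its first component. *)
Lemma sum_coordinate_eq0 f g L : pats_identity f ->
  \sum_(m <- msupp f) f@_m * (coordinate L (tmon_subst g m))%:~R = 0.
Proof.
move=> /(_ (pair_dialgebra free_alg) (fun x => generic (g x))).
rewrite /tpoly_eval => f0.
pose h (x : free_alg) : rat := \sum_(t <- L) t.1%:~R * x@_(FMonom t.2).
have {f0} : \sum_(m <- msupp f) f@_m *: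
    (tmon_eval (@pats _) generic (tmon_subst g m)).1 = 0.
  rewrite -[RHS]/((0 : pair_dialgebra free_alg).1) -f0 raddf_sum /=.
  by apply: eq_bigr => m _; rewrite eval_tmon_subst.
move/(congr1 h); rewrite /h [RHS]big1 => [h0|t _]; last by rewrite mcoeff0 mulr0.
rewrite -[RHS]h0.
under [RHS]eq_bigr do rewrite raddf_sum mulr_sumr.
rewrite exchange_big; apply: eq_bigr => m _ /=.
rewrite tmon_eval_generic /coordinate /=; case: ifP => _.
  rewrite pairingE mulr_sumr; apply: eq_bigr => t _.
  by rewrite mcoeffZ mulrCA.
by rewrite mulr0 big1 // => t _; rewrite scaler0 mcoeff0 mulr0.
Qed.

(** * Normal forms and their dual functionals *)

Definition monA : tmon nat :=
  TOp (TOp (TVar 0) (TVar 1) (TVar 2)) (TVar 3) (TVar 4).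
Definition monB : tmon nat :=
  TOp (TVar 0) (TOp (TVar 1) (TVar 2) (TVar 3)) (TVar 4).
Definition monC : tmon nat :=
  TOp (TVar 0) (TVar 1) (TOp (TVar 2) (TVar 3) (TVar 4)).

(* Each normal form comes with a functional on words that is proportional to its
   coordinate. The coefficients were found by solving the 10 linear equations
   given by the normal forms of degree 5 with centre 0; they are scaled so that
   summing over the symmetries of the normal form (4 for monA, 6 for monB) gives
   weight n. *)
Definition dual_basis (n : nat) : seq (wpoly * tmon nat) :=
  match n with
  | 1 => [:: ([:: (1, [:: 0]%N)], TVar 0)]
  | 3 => [:: ([:: (1, [:: 0; 1; 2]%N)], TOp (TVar 0) (TVar 1) (TVar 2))]
  | 5 => [:: ([:: (6, [:: 0; 1; 2; 3; 4]%N); (3, [:: 0; 1; 3; 2; 4]%N);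
                  (3, [:: 0; 4; 2; 3; 1]%N); (3, [:: 3; 1; 0; 2; 4]%N)], monA);
             ([:: (4, [:: 0; 1; 2; 3; 4]%N); (2, [:: 0; 1; 2; 4; 3]%N);
                  (- 2, [:: 0; 3; 2; 1; 4]%N); (2, [:: 1; 0; 2; 3; 4]%N)], monB)]
  | _ => [::]
  end.

Definition weight (n : nat) : nat :=
  match n with 3 => 2 | 5 => 36 | _ => 1 end.

(** In degree at most 5, the expansion of [weight n] times [m] modulo P and Q. Since [index^~ p]
    undoes the renaming [nth 0 p], the functional of a normal form reads the coordinate at its
    renamed copy. *)
Definition terms (n : nat) (m : tmon nat) : seq (int * tmon nat) :=
  [seq t <- [seq (coordinate b.1 (tmon_subst (index^~ p) m),
                  tmon_subst (nth 0 p) b.2)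
            | p <- permutations (iota 0 n), b <- dual_basis n] | t.1 != 0].

Lemma tmon_vars_dual_basis n b : b \in dual_basis n -> tmon_vars b.2 = iota 0 n.
Proof.
case: n => [|[|[|[|[|[|n]]]]]] //; rewrite !inE.
- by move=> /eqP->.
- by move=> /eqP->.
- by case/orP => /eqP->.
Qed.

Lemma map_nth_permutations (x0 : nat) (s : seq nat) : uniq s ->
  perm_eq (permutations s)
    [seq map (nth x0 s) p | p <- permutations (iota 0 (size s))].
Proof.
move=> s_uniq; have permE p : p \in permutations (iota 0 (size s)) ->
    {in p, forall i, i < size s}%N.
  by rewrite mem_permutations => /perm_mem pE i; rewrite pE mem_iota.
apply: uniq_perm => [||p]; first exact: permutations_uniq.
  rewrite map_inj_in_uniq ?permutations_uniq // => p q /permE ps /permE qs.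
  have nthK r : {in r, forall i, i < size s}%N ->
      map (index^~ s) (map (nth x0 s) r) = r.
    move=> rs; rewrite -map_comp -[RHS]map_id; apply/eq_in_map => i /rs i_lt.
    by rewrite /= index_uniq.
  by move=> /(congr1 (map (index^~ s))); rewrite !nthK.
rewrite mem_permutations.
by apply/(perm_iotaP x0)/mapP => -[q]; rewrite ?mem_permutations; exists q;
  rewrite ?mem_permutations.
Qed.

(** Numbering the variables by their positions in [t] reduces the expansion of any monomial to that
    of its shape [m]. *)
Lemma sum_permutations_terms (V : lmodType rat) (op : V -> V -> V -> V) v s t m :
  uniq t -> perm_eq t s -> tmon_vars m = iota 0 (size s) ->
  \sum_(p <- permutations s) \sum_(b <- dual_basis (size s))
    (coordinate b.1 (tmon_subst (index^~ p) (tmon_subst (nth 0%N t) m)))%:~R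
      *: tmon_eval op v (tmon_subst (nth 0%N p) b.2) =
  \sum_(u <- terms (size s) m)
    u.1%:~R *: tmon_eval op (fun i => v (nth 0%N t i)) u.2.
Proof.
move=> t_uniq ts mE; have szE := perm_size ts.
rewrite -(perm_big _ (perm_permutations ts)) /=.
rewrite (perm_big _ (map_nth_permutations 0 t_uniq)) big_map szE /=.
rewrite /terms big_filter [RHS]big_mkcond big_allpairs_dep /=.
apply: eq_big_seq => p; rewrite mem_permutations => ps.
have p_uniq : uniq p by rewrite (perm_uniq ps) iota_uniq.
have p_lt : {in p, forall i, i < size t}%N.
  by move=> i; rewrite (perm_mem ps) mem_iota szE.
apply: eq_big_seq => b /tmon_vars_dual_basis bE.
rewrite [tmon_subst (index^~ _) _]eval_tmon_subst.
(* [nth 0 t] is injective on positions, so it preserves indices in [p]. *)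
have -> : tmon_eval (@TOp nat)
    (fun i => TVar (index (nth 0%N t i) (map (nth 0%N t) p))) m =
    tmon_subst (index^~ p) m.
  apply: eq_in_tmon_eval => i; rewrite mE -(perm_mem ps) => ip.
  congr TVar; rewrite -{1}(nth_index 0%N ip).
  rewrite -[nth 0%N t _](nth_map 0%N 0%N (nth 0%N t)) ?index_mem //.
  rewrite index_uniq ?size_map ?index_mem // map_inj_in_uniq // => j k jp kp.
  by move/eqP; rewrite nth_uniq ?p_lt // => /eqP.
rewrite !eval_tmon_subst.
have -> : tmon_eval op (fun i => v (nth 0%N (map (nth 0%N t) p) i)) b.2 =
    tmon_eval op (fun i => v (nth 0%N t (nth 0%N p i))) b.2.
  apply: eq_in_tmon_eval => i; rewrite bE mem_iota => i_lt.
  by rewrite (nth_map 0%N) // (perm_size ps) size_iota.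
by case: eqP => //= ->; rewrite scale0r.
Qed.

(** * Monomials modulo P and Q *)

Lemma linear_opp (U V : lmodType rat) (h : U -> V) :
  linear h -> forall x, h (- x) = - h x.
Proof.
move=> lin_h x; have h0 : h 0 = 0.
  by have := lin_h (-1) 0 0; rewrite scaler0 addr0 scaleN1r addNr.
by have := lin_h (-1) x 0; rewrite h0 !addr0 !scaleN1r.
Qed.

Definition shapes : seq (tmon nat) :=
  [:: TVar 0%N; TOp (TVar 0%N) (TVar 1%N) (TVar 2%N); monA; monB; monC].

Lemma size_tmon_vars_gt0 (m : tmon nat) : (0 < size (tmon_vars m))%N.
Proof. by elim: m => //= m1 IH1 m2 _ m3 _; rewrite size_cat addn_gt0 IH1. Qed.

Lemma tmon_size_lt3 (m : tmon nat) : (size (tmon_vars m) < 3)%N ->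
  exists x, m = TVar x.
Proof.
case: m => [x _|m1 m2 m3]; first by exists x.
have := (size_tmon_vars_gt0 m1, size_tmon_vars_gt0 m2, size_tmon_vars_gt0 m3).
by case=> [[]]; rewrite /= !size_cat; lia.
Qed.

Lemma tmon_size_lt5 (m : tmon nat) : (size (tmon_vars m) < 5)%N ->
  (exists x, m = TVar x) \/
  exists x y z, m = TOp (TVar x) (TVar y) (TVar z).
Proof.
case: m => [x _|m1 m2 m3]; first by left; exists x.
rewrite /= !size_cat => m_lt.
have := (size_tmon_vars_gt0 m1, size_tmon_vars_gt0 m2, size_tmon_vars_gt0 m3).
case=> [[m1_gt m2_gt] m3_gt]; right.
have [|x ->] := @tmon_size_lt3 m1; first by lia.
have [|y ->] := @tmon_size_lt3 m2; first by lia.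
have [|z ->] := @tmon_size_lt3 m3; first by lia.
by exists x, y, z.
Qed.

Lemma tmon_shape (m : tmon nat) : (size (tmon_vars m) <= 5)%N ->
  exists2 m0, m0 \in shapes & m = tmon_subst (nth 0%N (tmon_vars m)) m0.
Proof.
case: m => [x _|m1 m2 m3]; first by exists (TVar 0%N).
have := (size_tmon_vars_gt0 m1, size_tmon_vars_gt0 m2, size_tmon_vars_gt0 m3).
case=> [[m1_gt m2_gt] m3_gt]; rewrite /= !size_cat => m_le.
have m1_lt : (size (tmon_vars m1) < 5)%N by lia.
have m2_lt : (size (tmon_vars m2) < 5)%N by lia.
have m3_lt : (size (tmon_vars m3) < 5)%N by lia.
case: (tmon_size_lt5 m1_lt) m_le => [[x1 ->]|[x1 [y1 [z1 ->]]]];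
  case: (tmon_size_lt5 m2_lt) => [[x2 ->]|[x2 [y2 [z2 ->]]]];
  case: (tmon_size_lt5 m3_lt) => [[x3 ->]|[x3 [y3 [z3 ->]]]] // _.
- by exists (TOp (TVar 0%N) (TVar 1%N) (TVar 2%N)).
- by exists monC.
- by exists monB.
- by exists monA.
Qed.

(** P and Q turn each monomial of [terms] into [m] up to a sign, which cancels the sign of its
    coordinate. *)
Lemma op_expansion (T : ternary_algebra) :
  (forall a b c : T, ta_op a c b = - ta_op a b c) ->
  (forall a b c d e : T,
     ta_op a (ta_op c b d) e = - ta_op a (ta_op b c d) e) ->
  forall (v : nat -> T) m, m \in shapes ->
  (weight (size (tmon_vars m)))%:R *: tmon_eval (@ta_op T) v m =
  \sum_(u <- terms (size (tmon_vars m)) m)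
    u.1%:~R *: tmon_eval (@ta_op T) v u.2.
Proof.
move=> opP opQ v m.
have opN1 (a b c : T) := linear_opp (ta_linear1 b c) a.
have opN2 (a b c : T) := linear_opp (ta_linear2 a c) b.
rewrite !inE => /or4P[/eqP->|/eqP->|/eqP->|/orP[]/eqP->];
  set ts := terms _ _; vm_compute in ts; rewrite {}/ts !big_cons big_nil addr0 /=.
- by [].
- by rewrite (opP _ (v 1%N)) scalerN -scaleNr -!scalerDl.
- rewrite !(opP _ (v 3%N) (v 4%N)) !(opP _ (v 1%N) (v 2%N)) !opN1.
  by rewrite !scalerN -!scaleNr -!scalerDl.
(* P orders the last two entries of the inner product, Q brings its least variable to the front, and
   P orders the rest. *)
- rewrite !(opP (v 3%N) (v 1%N) (v 2%N)) !(opP (v 2%N) (v 1%N) (v 3%N)).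
  rewrite !opN2 !(opQ _ (v 1%N)) !(opP _ (v 2%N) (v 3%N)).
  by rewrite !opN2 !opprK !scalerN -!scaleNr -!scalerDl.
- rewrite !(opP (v 4%N) (v 2%N) (v 3%N)) !(opP (v 3%N) (v 2%N) (v 4%N)).
  rewrite !opN2 !(opQ _ (v 2%N)) !(opP _ (v 3%N) (v 4%N)).
  rewrite !opN2 !(opP (v 0%N) (v 1%N)) !opprK.
  by rewrite !scalerN -!scaleNr -!scalerDl.
Qed.

(** * From vanishing coordinates to consequences of P and Q *)

Lemma tpoly_eval_binomial (V : lmodType rat) (op : V -> V -> V -> V) v m1 m2 :
  m1 != m2 ->
  tpoly_eval op v (<< m1 >> + << m2 >>) = tmon_eval op v m1 + tmon_eval op v m2.
Proof.
move=> m12; rewrite /tpoly_eval msuppD !msuppU oner_eq0; last first.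
  by rewrite fdisjoint1X inE.
rewrite big_fsetU1 ?inE //= big_seq_fset1 !mcoeffD !mcoeffU !eqxx.
by rewrite (negPf m12) eq_sym (negPf m12) addr0 add0r !scale1r.
Qed.

Theorem proposition4p3 (n : nat) (f : tpoly) :
  (n <= 5)%N -> multilinear n f -> pats_identity f ->
  consequence (fun g => g = identP \/ g = identQ) f.
Proof.
move=> n_le5 [s [s_uniq s_size f_vars]] f_pats T T_ids v.
have opP (a b c : T) : ta_op a c b = - ta_op a b c.
  have := T_ids _ (or_introl erefl) (nth a [:: a; b; c]).
  by rewrite tpoly_eval_binomial //= => /addr0_eq.
have opQ (a b c d e : T) :
    ta_op a (ta_op c b d) e = - ta_op a (ta_op b c d) e.
  have := T_ids _ (or_intror erefl) (nth a [:: a; b; c; d; e]).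
  by rewrite tpoly_eval_binomial //= => /addr0_eq.
have weight_neq0 : (weight n)%:R != 0 :> rat.
  by case: n {n_le5 s_size} => [|[|[|[|[|[|n]]]]]].
apply: (scalerI weight_neq0); rewrite scaler0 scaler_sumr.
have expand m : m \in msupp f -> (weight n)%:R *: tmon_eval (@ta_op T) v m =
    \sum_(p <- permutations s) \sum_(b <- dual_basis n)
      (coordinate b.1 (tmon_subst (index^~ p) m))%:~R
        *: tmon_eval (@ta_op T) v (tmon_subst (nth 0%N p) b.2).
  move=> /f_vars m_s; have m_size : size (tmon_vars m) = n.
    by rewrite (perm_size m_s).
  have [|m0 m0_shape mE] := @tmon_shape m; first by rewrite m_size.
  have m0_vars : tmon_vars m0 = iota 0 n.
    rewrite -m_size mE size_tmon_vars_subst; move: m0_shape.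
    by rewrite !inE => /or4P[/eqP->|/eqP->|/eqP->|/orP[]/eqP->].
  rewrite {2}mE -s_size sum_permutations_terms ?s_size //; last first.
    by rewrite (perm_uniq m_s).
  have := op_expansion opP opQ (fun i => v (nth 0%N (tmon_vars m) i)) m0_shape.
  by rewrite m0_vars size_iota => <-; rewrite {1}mE eval_tmon_subst.
rewrite (eq_big_seq (fun m => \sum_(p <- permutations s)
  \sum_(b <- dual_basis n)
    (f@_m * (coordinate b.1 (tmon_subst (index^~ p) m))%:~R)
      *: tmon_eval (@ta_op T) v (tmon_subst (nth 0%N p) b.2))); last first.
  move=> m m_f; rewrite scalerA mulrC -scalerA expand // scaler_sumr.
  apply: eq_bigr => p _; rewrite scaler_sumr.
  by apply: eq_bigr => b _; rewrite scalerA.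
(* For fixed [p] and [b], the sum over [m] is the functional [b.1] applied to the value of the
   renamed [f], hence zero. *)
rewrite exchange_big big1 // => p _; rewrite exchange_big big1 // => b _.
by rewrite -scaler_suml sum_coordinate_eq0 // scale0r.
Qed.
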